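(* Let $\theta$ be a real number. A graph $G$ is $\theta$-elementary if and only if $\mathfrak P(\theta,G)$ is a partition of $V(G)$.
   Context: All graphs are finite and simple. For a graph $G$ on $n$ vertices, let $p(G,r)$ be the number of $r$-matchings in $G$, $p(G,0)=1$; $\mu(G,x)=\sum_{r=0}^{\lfloor n/2\rfloor}(-1)^r p(G,r)x^{n-2r}$ is the matching polynomial. $\mathrm{mult}(\theta,G)$ is the multiplicity of $\theta$ as a root of $\mu(G,x)$. $G\setminus X$ denotes deletion of the vertex set $X$. A vertex $u$ is $\theta$-essential if $\mathrm{mult}(\theta,G\setminus u)=\mathrm{mult}(\theta,G)-1$, $\theta$-neutral if $\mathrm{mult}(\theta,G\setminus u)=\mathrm{mult}(\theta,G)$, $\theta$-positive if $\mathrm{mult}(\theta,G\setminus u)=\mathrm{mult}(\theta,G)+1$; $u$ is $\theta$-special if it is not $\theta$-essential but is adjacent to some $\theta$-essential vertex. $A_\theta(G)$ is the set of $\theta$-special vertices and $P_\theta(G)$ is the set of $\theta$-positive vertices that are not $\theta$-special. $G$ is $\theta$-super positive if $\mathrm{mult}(\theta,G)=0$ and every vertex is $\theta$-positive; $G$ is $\theta$-elementary if it is $\theta$-super positive and $P_\theta(G\setminus v)=\varnothing$ for all $v\in V(G)$. A graph is $\theta$-critical if all its vertices are $\theta$-essential and $\mathrm{mult}(\theta,G)=1$; $c_\theta(G)$ is the number of $\theta$-critical connected components of $G$. $X\subseteq V(G)$ is a $\theta$-barrier set if $\mathrm{mult}(\theta,G)=c_\theta(G\setminus X)-|X|$.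 $\mathfrak P(\theta,G)$ is the set of all $\theta$-barrier sets of $G$.
   Formalization: The empty set, which is a θ-barrier set of every θ-elementary graph, is left out of 𝔓(θ,G): the theorem says that G is θ-elementary if and only if the nonempty θ-barrier sets form a partition of V(G). *)

(* Defs.v *)
From HB Require Import structures.
From mathcomp Require Import all_boot all_order all_algebra.
From mathcomp Require Import reals.

Set Implicit Arguments.
Unset Strict Implicit.
Unset Printing Implicit Defensive.

Import Order.TTheory GRing.Theory Num.Theory.
Local Open Scope ring_scope.

(* A simple graph G on the vertex type T is given by its adjacency relation   *)
(* e (symmetric and irreflexive).  Every graph considered is an induced       *)
(* subgraph G[S], so all notions below take the vertex set S as an argument:  *)
(* G itself is S = [set: T], and deleting X from G[S] gives G[S :\: X].       *)

Section MatchingPolynomial.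

Variables (R : realType) (T : finType) (e : rel T).
Implicit Types (S X C : {set T}) (theta : R).

Definition edges S : {set {set T}} :=
  [set A : {set T} |
    [exists x in S, exists y in S, e x y && (A == [set x; y])]].

Definition is_matching S (M : {set {set T}}) : bool :=
  (M \subset edges S) && trivIset M.

Definition num_matchings S (r : nat) : nat :=
  #|[set M : {set {set T}} | is_matching S M & #|M| == r]|.

Definition matching_poly S : {poly R} :=
  \sum_(r < (#|S| %/ 2).+1)
    ((-1) ^+ r * (num_matchings S r)%:R) *: 'X^(#|S| - 2 * r).

Definition mult theta S : nat := mup theta (matching_poly S).

(* mult(G \ u) = mult(G) - 1, written without truncated subtraction. *)
Definition essential theta S (u : T) : bool :=
  (u \in S) && ((mult theta (S :\ u)).+1 == mult theta S)%N.

Definition neutral theta S (u : T) : bool :=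
  (u \in S) && (mult theta (S :\ u) == mult theta S).

Definition positive theta S (u : T) : bool :=
  (u \in S) && (mult theta (S :\ u) == (mult theta S).+1)%N.

Definition special theta S (u : T) : bool :=
  [&& u \in S, ~~ essential theta S u &
      [exists w in S, e u w && essential theta S w]].

Definition A_set theta S : {set T} := [set u | special theta S u].

Definition P_set theta S : {set T} :=
  [set u | positive theta S u & u \notin A_set theta S].

Definition super_positive theta S : bool :=
  (mult theta S == 0)%N && [forall u in S, positive theta S u].

Definition elementary theta S : bool :=
  super_positive theta S && [forall v in S, P_set theta (S :\ v) == set0].

Definition critical theta S : bool :=
  [forall u in S, essential theta S u] && (mult theta S == 1)%N.

Definition induced_rel S : rel T := [rel x y | [&& x \in S, y \in S & e x y]].

Definition components S : {set {set T}} :=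
  equivalence_partition (connect (induced_rel S)) S.

Definition num_critical theta S : nat :=
  #|[set C in components S | critical theta C]|.

(* mult(G) = c(G \ X) - |X| is an equation between integers: the right-hand  *)
(* side may be negative.                                                      *)
Definition barrier theta S X : bool :=
  (X \subset S) &&
  ((mult theta S)%:Z == (num_critical theta (S :\: X))%:Z - #|X|%:Z).

(* If mult(theta, G) = 0 then no component of G is theta-critical, so set0 is  *)
(* a barrier set; this is the case for every theta-elementary G.  The barrier *)
(* sets can thus only partition V(G) up to this empty member: as the blocks   *)
(* of [partition] are nonempty, it has to be applied to barriers :\ set0.     *)
Definition barriers theta S : {set {set T}} := [set X | barrier theta S X].

End MatchingPolynomial.

(* Main.v *)
(* Write f_S for the matching polynomial of G[S].  The Heilmann-Lieb difference
   f_{S-u} f_{S-v} - f_S f_{S-u-v} is a sum of squares, and squares vanish to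
   even order at theta.  Comparing orders of vanishing gives interlacing, the
   stability lemma (deleting a special vertex preserves the type of every other
   vertex) and Gallai's lemma (a connected graph all of whose vertices are
   essential has multiplicity 1).  The configurations that escape this
   parity argument are excluded by adding a weighted loop at a vertex, which
   changes some multiplicities without destroying the recurrence, and this is
   why the argument is run for families of polynomials satisfying the
   recurrence with vertex weights.

   Stability and Gallai's lemma make A(G) a barrier, and the only barrier when
   P(G) is empty.  If v is positive, the barriers of G through v are the sets
   {v} + Y with Y a barrier of G - v.  So if every P(G - v) is empty, exactly
   one barrier passes through each v.  Conversely, u in P(G - v) would give the
   two distinct barriers {v} + A(G - v) and {v, u} + A(G - v - u). *)
Require Import Defs.
From mathcomp Require Import all_boot all_order all_algebra.
From mathcomp Require Import reals.
From mathcomp Require Import zify ring.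

Set Implicit Arguments.
Unset Strict Implicit.
Unset Printing Implicit Defensive.

Import Order.TTheory GRing.Theory Num.Theory.
Local Open Scope ring_scope.

(** * Sums of squares of polynomials *)

Section SumsOfSquares.

Variables (R : realFieldType) (x : R).
Implicit Types (p q : {poly R}) (n : nat).
Local Notation t := ('X - x%:P).

Definition sos p := exists s : seq {poly R}, p = \sum_(q <- s) q ^+ 2.

Lemma sos0 : sos 0.
Proof. by exists [::]; rewrite big_nil. Qed.

Lemma sos_sqr p : sos (p ^+ 2).
Proof. by exists [:: p]; rewrite big_seq1. Qed.

Lemma sosD p q : sos p -> sos q -> sos (p + q).
Proof. by move=> [s ->] [s' ->]; exists (s ++ s'); rewrite big_cat. Qed.

Lemma sos_sum (I : finType) (P : pred I) (F : I -> {poly R}) :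
  (forall i, P i -> sos (F i)) -> sos (\sum_(i | P i) F i).
Proof. by move=> sosF; apply: big_ind => //; [exact: sos0 | exact: sosD]. Qed.

Lemma sos_horner_ge0 p : sos p -> 0 <= p.[x].
Proof.
case=> s ->; rewrite horner_sum.
by apply: sumr_ge0 => q _; rewrite horner_exp exprn_even_ge0.
Qed.

(** At a real root every square in the sum vanishes, so [t] divides every base and [t ^+ 2] comes
    out of the whole sum. *)
Lemma sos_root p : sos p -> root p x -> exists2 q, sos q & p = t ^+ 2 * q.
Proof.
case=> s ->; elim: s => [_|q s IHs].
  by exists 0; [exact: sos0 | rewrite big_nil mulr0].
have /sos_horner_ge0 s_ge0 : sos (\sum_(q <- s) q ^+ 2) by exists s.
rewrite big_cons rootE hornerD paddr_eq0 ?horner_exp ?exprn_even_ge0 //.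
rewrite sqrf_eq0 -/(root q x) => /andP[/factor_theorem[q1 ->] /IHs[r sos_r ->]].
exists (q1 ^+ 2 + r); first exact: sosD (sos_sqr _) sos_r.
by rewrite exprMn mulrDr [q1 ^+ 2 * _]mulrC.
Qed.

(** Sums of squares cannot cancel: a root of [p + q] is a root of both, so [t ^+ 2] is stripped from
    both until the exponent is at most 1. *)
Lemma sosD_dvd n p q : sos p -> sos q -> t ^+ n %| p + q -> t ^+ n %| p.
Proof.
elim/ltn_ind: n p q => -[_ p q _ _ _|n IHn p q sos_p sos_q dv].
  by rewrite dvd1p.
have : root (p + q) x.
  by rewrite -dvdp_XsubCl; apply: dvdp_trans dv; rewrite exprS dvdp_mulr.
rewrite rootE hornerD paddr_eq0 ?sos_horner_ge0 // => /andP[p0 q0].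
have [p1 sos_p1 Ep] := sos_root sos_p p0.
have [q1 sos_q1 Eq] := sos_root sos_q q0.
rewrite {}Ep {}Eq -mulrDr in dv *.
case: n => [|n] in IHn dv *; first by rewrite expr1 exprS -mulrA dvdp_mulr.
have nz : t ^+ 2 != 0 by rewrite expf_neq0 // polyXsubC_eq0.
move: dv; rewrite -addn2 addnC exprD !dvdp_mul2l //; exact: IHn.
Qed.

(** Stripping factors [t ^+ 2] from an odd exponent ends at 1, where a root is automatically
    double. *)
Lemma sos_dvd_odd n p :
  odd n -> sos p -> t ^+ n %| p -> t ^+ n.+1 %| p.
Proof.
elim/ltn_ind: n p => -[//|n IHn] p odd_n sos_p dv.
have : root p x.
  by rewrite -dvdp_XsubCl; apply: dvdp_trans dv; rewrite exprS dvdp_mulr.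
case/(sos_root sos_p) => q sos_q Ep; rewrite {}Ep in dv *.
case: n => [|n] in IHn odd_n dv *; first by rewrite dvdp_mulr.
have nz : t ^+ 2 != 0 by rewrite expf_neq0 // polyXsubC_eq0.
move: dv; rewrite -[n.+3]addn2 -addn2 ![(_ + 2)%N]addnC !exprD !dvdp_mul2l //.
by apply: IHn => //; rewrite /= negbK in odd_n.
Qed.

(** Were the order of [q] larger, [p - q] would vanish to exactly the order of [p], which is odd.
    This is the source of the parity arguments below. *)
Lemma sosB_odd_mupl p q : p != 0 -> q != 0 -> sos (p - q) ->
  odd (mup x p) -> (mup x q <= mup x p)%N.
Proof.
move=> p0 q0 sos_pq odd_p; rewrite leqNgt; apply/negP => lt_pq.
have dq : t ^+ (mup x p).+1 %| q by rewrite -mup_geq.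
have: t ^+ (mup x p).+1 %| p - q.
  apply: sos_dvd_odd => //; rewrite dvdp_sub //.
    by rewrite -mup_geq.
  by rewrite -mup_geq // ltnW.
by rewrite dvdp_subl // -mup_geq // ltnn.
Qed.

Lemma sosB_odd_mupr p q : p != 0 -> q != 0 -> sos (p - q) ->
  odd (mup x q) -> (mup x p <= mup x q)%N.
Proof.
move=> p0 q0 sos_pq odd_q; rewrite leqNgt; apply/negP => lt_qp.
have dp : t ^+ (mup x q).+1 %| p by rewrite -mup_geq.
have: t ^+ (mup x q).+1 %| p - q.
  apply: sos_dvd_odd => //; rewrite dvdp_sub //.
    by rewrite -mup_geq // ltnW.
  by rewrite -mup_geq.
by rewrite dvdp_subr // -mup_geq // ltnn.
Qed.

(** With [p = q * t ^+ n], the derivative forces [t] to divide [n%:R * q], hence [q], as [n] is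
    positive and the characteristic is zero. *)
Lemma dvd_deriv n p : p != 0 -> (0 < n)%N -> t ^+ n %| p -> t ^+ n %| p^`() ->
  t ^+ n.+1 %| p.
Proof.
case: n => // n p0 _ /dvdpP[q ->]; rewrite derivM deriv_exp derivXsubC.
rewrite dvdp_addr ?(dvdp_mull _ (dvdpp _)) // mul1r -mulr_natl -polyC_natr /=.
rewrite mulrA exprS dvdp_mul2r ?expf_neq0 ?polyXsubC_eq0 //.
rewrite mulrC mul_polyC dvdpZr ?pnatr_eq0 // => dq.
by rewrite -exprS [t ^+ n.+2]exprS dvdp_mul.
Qed.

Lemma dvdp_derivX n p : t ^+ n.+1 %| p -> t ^+ n %| p^`().
Proof.
case/dvdpP=> q ->; rewrite derivM deriv_exp /= derivXsubC mul1r dvdp_add //.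
  by rewrite dvdp_mull // exprS dvdp_mull.
by rewrite dvdp_mull // -mulr_natl dvdp_mull.
Qed.

End SumsOfSquares.

(** * Families satisfying the matching recurrence *)

Lemma setD1AC (T : finType) (S : {set T}) u v : S :\ u :\ v = S :\ v :\ u.
Proof. by rewrite !setDDl setUC. Qed.

Lemma setD1_notin (T : finType) (S : {set T}) u : u \notin S -> S :\ u = S.
Proof.
move=> uS; apply/setP => x; rewrite in_setD1.
by case: eqVneq => // ->; rewrite (negbTE uS).
Qed.

(** The expansion of a matching polynomial at [u], for a graph with a loop of weight [y u] at each
    vertex [u]; zero weights give the usual recurrence. *)
Definition matching_family (R : realFieldType) (T : finType) (e : rel T)
    (y : T -> R) (f : {set T} -> {poly R}) : Prop :=
  f set0 = 1 /\ forall (S : {set T}) u, u \in S ->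
    f S = ('X - (y u)%:P) * f (S :\ u)
          - \sum_(i in S :\ u | e u i) f (S :\ u :\ i).

Definition hl_diff (R : realFieldType) (T : finType) (f : {set T} -> {poly R})
    (S : {set T}) (u v : T) : {poly R} :=
  f (S :\ u) * f (S :\ v) - f S * f (S :\ u :\ v).

Section MatchingFamily.

Variables (R : realFieldType) (T : finType) (e : rel T) (y : T -> R).
Variable f : {set T} -> {poly R}.
Hypothesis mf : matching_family e y f.
Implicit Types (S : {set T}) (u v w : T).

Lemma mf_rec S u : u \in S ->
  f S = ('X - (y u)%:P) * f (S :\ u)
        - \sum_(i in S :\ u | e u i) f (S :\ u :\ i).
Proof. by case: mf => _; apply. Qed.

Lemma size_mf S : size (f S) = #|S|.+1.
Proof.
have [n leS] := ubnP #|S|; elim: n => // n IHn in S leS *.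
have [->|[u uS]] := set_0Vmem S; first by case: mf => -> _; rewrite size_poly1 cards0.
have cS : #|S| = #|S :\ u|.+1 by rewrite (cardsD1 u) uS.
have szu : size (f (S :\ u)) = #|S| by rewrite IHn; lia.
have szM : size (('X - (y u)%:P) * f (S :\ u)) = #|S|.+1.
  rewrite size_proper_mul ?size_XsubC ?szu // lead_coefXsubC mul1r lead_coef_eq0.
  by rewrite -size_poly_gt0 szu cS.
rewrite (mf_rec uS) size_polyDl ?szM // size_polyN.
apply: leq_ltn_trans (size_sum _ _ _) _; apply/bigmax_leqP => i /andP[iS _].
have ci : #|S :\ u| = #|S :\ u :\ i|.+1 by rewrite (cardsD1 i (S :\ u)) iS.
by rewrite IHn; lia.
Qed.

Lemma mf_neq0 S : f S != 0.
Proof. by rewrite -size_poly_gt0 size_mf. Qed.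

(** The expansion at [u] is differentiated by induction, each other [f (S :\ v)] is expanded at the
    same [u], and the double sums agree after an exchange. *)
Lemma deriv_mf S : (f S)^`() = \sum_(u in S) f (S :\ u).
Proof.
have [n leS] := ubnP #|S|; elim: n => // n IHn in S leS *.
have [->|[u uS]] := set_0Vmem S.
  by case: mf => -> _; rewrite -polyC1 derivC big_set0.
have cS : #|S| = #|S :\ u|.+1 by rewrite (cardsD1 u) uS.
rewrite (big_setD1 u) //= {1}(mf_rec uS) derivB derivM derivXsubC mul1r -addrA.
congr (_ + _); rewrite IHn; last by lia.
have -> : (\sum_(i in S :\ u | e u i) f (S :\ u :\ i))^`() =
    \sum_(i in S :\ u | e u i) \sum_(v in S :\ u :\ i) f (S :\ u :\ i :\ v).
  rewrite raddf_sum; apply: eq_bigr => i /andP[iS _]; rewrite /= IHn //.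
  by rewrite (cardsD1 i (S :\ u)) iS in cS; lia.
rewrite mulr_sumr.
have -> : \sum_(v in S :\ u) ('X - (y u)%:P) * f (S :\ u :\ v) =
    \sum_(v in S :\ u) ('X - (y u)%:P) * f (S :\ v :\ u).
  by apply: eq_bigr => v _; rewrite setD1AC.
under [RHS]eq_bigr => v.
  rewrite in_setD1 => /andP[vu vS].
  rewrite (@mf_rec (S :\ v) u) ?in_setD1 1?eq_sym ?vu //.
  over.
rewrite big_split sumrN /=; congr (_ - _).
rewrite (exchange_big_dep (mem (S :\ u))) /=; last first.
  by move=> i v _; rewrite 2!in_setD1 => /andP[].
apply: eq_bigr => v vS; apply: eq_big => [i|i _].
  rewrite !in_setD1; case: (eqVneq i v) => [->|]; rewrite ?eqxx ?andbF //=.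
  by rewrite in_setD1 in vS; case/andP: vS => -> ->; rewrite andbT;
    case: (i == u); case: (i \in S); rewrite ?andbF ?andbT.
by rewrite [S :\ v :\ u]setD1AC [in RHS]setD1AC.
Qed.

(** In the expansions of [f S] and [f (S :\ v)] at [u] the weighted terms cancel; [v], absent from
    the second expansion, contributes the square if it is a neighbour of [u]. *)
Lemma hl_diff_rec S u v : u \in S -> v \in S -> u != v ->
  hl_diff f S u v = \sum_(i in S :\ u :\ v | e u i) hl_diff f (S :\ u) i v
    + (if e u v then f (S :\ u :\ v) ^+ 2 else 0).
Proof.
move=> uS vS uv; have uSv : u \in S :\ v by rewrite in_setD1 uv.
have vSu : v \in S :\ u by rewrite in_setD1 eq_sym uv.
rewrite /hl_diff (mf_rec uS) (mf_rec uSv) sumrB -mulr_suml -mulr_sumr.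
have -> : \sum_(i in S :\ u | e u i) f (S :\ u :\ i) =
    (if e u v then f (S :\ u :\ v) else 0)
    + \sum_(i in S :\ u :\ v | e u i) f (S :\ u :\ i).
  rewrite big_mkcondr (big_setD1 v) //= -big_mkcondr.
  by rewrite [in RHS]big_mkcondr /= [in LHS]big_mkcondr.
rewrite [S :\ v :\ u]setD1AC.
under [X in _ - f _ * X]eq_bigr do rewrite setD1AC.
case: (e u v); ring.
Qed.

(** Unrolled, the recurrence sums [f (S :\: P) ^+ 2] over the paths from [u] to [v], [P] being the
    vertex set of the path. *)
Lemma sos_hl_diff S u v : u \in S -> v \in S -> u != v -> sos (hl_diff f S u v).
Proof.
have [n leS] := ubnP #|S|; elim: n => // n IHn in S u v leS *.
move=> uS vS uv; rewrite hl_diff_rec //; apply: sosD; last first.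
  by case: ifP => _; [exact: sos_sqr | exact: sos0].
apply: sos_sum => i /andP[]; rewrite !in_setD1 => /and3P[iv iu iS] _.
by apply: IHn; rewrite ?in_setD1 ?iu ?iv ?vS 1?eq_sym ?uv //;
  rewrite (cardsD1 u) uS in leS; lia.
Qed.

(** Isolates the path that consists of the single edge from [u] to [v]. *)
Lemma hl_diff_edge S u v : u \in S -> v \in S -> u != v -> e u v ->
  exists2 q, sos q & hl_diff f S u v = f (S :\ u :\ v) ^+ 2 + q.
Proof.
move=> uS vS uv euv; rewrite hl_diff_rec // euv addrC; eexists; last by [].
apply: sos_sum => i /andP[]; rewrite !in_setD1 => /and3P[iv iu iS] _.
by apply: sos_hl_diff; rewrite // in_setD1 ?iu ?iS // eq_sym uv.
Qed.

(** Isolates the paths whose first edge goes from [u] to [a]. *)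
Lemma hl_diff_step S u v a : u \in S -> v \in S -> u != v ->
  a \in S -> a != u -> a != v -> e u a ->
  exists2 q, sos q & hl_diff f S u v = hl_diff f (S :\ u) a v + q.
Proof.
move=> uS vS uv aS au av eua.
rewrite hl_diff_rec // (bigD1 a) ?in_setD1 ?au ?av ?aS //= -addrA.
eexists; last by []; apply: sosD.
  apply: sos_sum => i /andP[/andP[]]; rewrite !in_setD1 => /and3P[iv iu iS] _ _.
  by apply: sos_hl_diff; rewrite // in_setD1 ?iu ?iS // eq_sym uv.
by case: ifP => _; [exact: sos_sqr | exact: sos0].
Qed.

End MatchingFamily.

(** * Multiplicities of a root *)

Lemma mup_addl (R : realFieldType) (x : R) (p q : {poly R}) : p != 0 ->
  ('X - x%:P) ^+ (mup x p).+1 %| q -> mup x (p + q) = mup x p.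
Proof.
move=> p0 dq; have nd : ~~ (('X - x%:P) ^+ (mup x p).+1 %| p + q).
  by rewrite dvdp_addl // -mup_geq // ltnn.
have pq0 : p + q != 0 by apply: contraNneq nd => ->; rewrite dvdp0.
apply/eqP; rewrite eqn_leq mup_leq // nd mup_geq // dvdp_add //.
  by rewrite -mup_geq.
by apply: dvdp_trans dq; rewrite exprS dvdp_mull.
Qed.

Lemma mup_cancel (R : realFieldType) (x : R) (p q : {poly R}) :
  p != 0 -> q != 0 -> mup x p = mup x q ->
  exists z, ('X - x%:P) ^+ (mup x p).+1 %| p + z *: q.
Proof.
move=> p0 q0; have [k [p1]] := multiplicity_XsubC p x; rewrite p0 /= => rp ->.
have [l [q1]] := multiplicity_XsubC q x; rewrite q0 /= => rq ->.
(* This [z] cancels the lowest-order coefficients of the two polynomials at [x]. *)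
rewrite !mupMr // !mup_XsubCX eqxx => <-; exists (- (p1.[x] / q1.[x])).
rewrite scalerAl -mulrDl exprS dvdp_mul // dvdp_XsubCl rootE hornerD hornerZ.
by rewrite mulNr divfK ?subrr // -rootE.
Qed.

(** Multiplicities become plain variables for [lia]. The [clear] drops hypotheses that mention none,
    so any such fact must first be moved to the goal. *)
Ltac mup_lia :=
  repeat match goal with
    | H : context [mup ?x ?p] |- _ => revert H
    | H : context [mult ?e ?x ?S] |- _ => revert H
  end;
  repeat match goal with
    | |- context [mup ?x ?p] => generalize (mup x p)
    | |- context [mult ?e ?x ?S] => generalize (mult e x S)
  end;
  clear; lia.

(** Replacing [y a] by [y a - z] in the recurrence at [a] adds exactly this term; vertex sets
    without [a] are unaffected. *)
Definition loop (R : realFieldType) (T : finType) (f : {set T} -> {poly R})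
    (a : T) (z : R) (S : {set T}) : {poly R} :=
  f S + (if a \in S then z *: f (S :\ a) else 0).

Section Multiplicity.

Variables (R : realFieldType) (T : finType) (e : rel T) (theta : R).
Hypotheses (e_sym : symmetric e) (e_irr : irreflexive e).
Implicit Types (S : {set T}) (u v w a : T) (y : T -> R).
Implicit Type f : {set T} -> {poly R}.
Local Notation t := ('X - theta%:P).

Lemma loop_family y f a z : matching_family e y f ->
  matching_family e (fun u => if u == a then y a - z else y u) (loop f a z).
Proof.
move=> mf; split=> [|S u uS].
  by rewrite /loop in_set0 addr0; case: mf.
rewrite /loop (mf_rec mf uS); have [Eu|ua] := eqVneq u a.
  subst u; rewrite uS in_setD1 eqxx /= addr0.
  under [in RHS]eq_bigr do rewrite !in_setD1 eqxx andbF /= addr0.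
  by rewrite polyCB -mul_polyC; ring.
rewrite !in_setD1 [a == u]eq_sym ua /=; case: ifP => aS; last first.
  rewrite !addr0; under [in RHS]eq_bigr do rewrite !in_setD1 aS !andbF addr0.
  by [].
have uSa : u \in S :\ a by rewrite in_setD1 ua.
rewrite (mf_rec mf uSa) big_split /=.
(* The index [i = a] carries no correction, since [a] is deleted there; the other terms are the sum
   in the expansion of [f (S :\ a)] at [u]. *)
have -> : \sum_(i in S :\ u | e u i) (if a \in S :\ u :\ i then
      z *: f (S :\ u :\ i :\ a) else 0) =
    z *: \sum_(i in S :\ a :\ u | e u i) f (S :\ a :\ u :\ i).
  rewrite scaler_sumr big_mkcondr [RHS]big_mkcondr /=.
  rewrite (big_setD1 a) ?in_setD1 1?[a == u]eq_sym ?ua //= eqxx /= if_same add0r.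
  rewrite [S :\ u :\ a]setD1AC; apply: eq_bigr => i.
  rewrite !in_setD1 => /and3P[iu ia iS].
  rewrite [a == i]eq_sym ia [a == u]eq_sym ua aS /=.
  by rewrite [S :\ u :\ i :\ a]setD1AC [S :\ u :\ a]setD1AC.
rewrite [S :\ u :\ a]setD1AC -!mul_polyC; ring.
Qed.

(** * Interlacing and parity inequalities *)

Section Family.

Variables (y : T -> R) (f : {set T} -> {poly R}).
Hypothesis mf : matching_family e y f.
Local Notation m S := (mup theta (f S)).

Let f0 S : f S != 0. Proof. exact: mf_neq0 mf S. Qed.
Let dvd_m n S : (n <= m S)%N = (t ^+ n %| f S).
Proof. by rewrite mup_geq. Qed.

(** By [deriv_mf], the Wronskian of [f S] and [f (S :\ u)] is a sum of squares containing
    [f (S :\ u) ^+ 2], so this square vanishes at least as fast as the Wronskian. *)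
Lemma mult_le_del S u : u \in S -> (m S <= (m (S :\ u)).+1)%N.
Proof.
move=> uS; rewrite leqNgt; apply/negP => lt.
have [k Ek] : exists k, m S = k.+2 by exists (m S - 2)%N; lia.
suff: t ^+ (m (S :\ u) + k.+1) %| f (S :\ u) ^+ 2.
  by rewrite -mup_geq ?expf_neq0 // expr2 mupM //; lia.
pose q := \sum_(v in S :\ u) hl_diff f S u v.
apply: (@sosD_dvd _ theta _ _ q); first exact: sos_sqr.
  apply: sos_sum => v; rewrite in_setD1 => /andP[vu vS].
  by apply: (sos_hl_diff mf) => //; rewrite eq_sym.
have -> : f (S :\ u) ^+ 2 + q = f (S :\ u) * (f S)^`() - f S * (f (S :\ u))^`().
  rewrite !(deriv_mf mf) (big_setD1 u) //= mulrDr -addrA expr2 !mulr_sumr.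
  by rewrite -sumrB.
rewrite dvdp_sub //.
  by rewrite exprD dvdp_mul -?dvd_m // dvdp_derivX // -Ek -dvd_m.
case: (posnP (m (S :\ u))) => [->|mu].
  by rewrite add0n dvdp_mulr // -dvd_m Ek.
rewrite -(prednK mu) addSnnS addnC -Ek exprD dvdp_mul -?dvd_m //.
by rewrite dvdp_derivX // prednK // -dvd_m.
Qed.

(** By [mult_le_del], every term of the recurrence at [u] vanishes to order at least
    [m (S :\ u) - 1]. *)
Lemma mult_del_le S u : u \in S -> (m (S :\ u) <= (m S).+1)%N.
Proof.
move=> uS; case Em : (m (S :\ u)) => [//|k]; rewrite ltnS dvd_m (mf_rec mf uS).
rewrite dvdp_sub //; first by rewrite dvdp_mull // -dvd_m Em.
apply: (big_ind (fun p => t ^+ k %| p)) => [||i /andP[iS _]].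
- exact: dvdp0.
- by move=> *; exact: dvdp_add.
by rewrite -dvd_m; have := mult_le_del iS; lia.
Qed.

(** Otherwise every term of [deriv_mf] would vanish to order [m S], and then [f S] to order
    [(m S).+1]. *)
Lemma exists_essential S : (0 < m S)%N ->
  exists2 u, u \in S & (m (S :\ u)).+1 = m S.
Proof.
move=> mS; have [/existsP[u /andP[uS /eqP Eu]]|] :=
  boolP [exists u, (u \in S) && ((m (S :\ u)).+1 == m S)%N].
  by exists u.
rewrite negb_exists => /forallP no.
suff: t ^+ (m S).+1 %| f S by rewrite -dvd_m ltnn.
apply: dvd_deriv => //; first by rewrite -dvd_m.
rewrite (deriv_mf mf).
apply: (big_ind (fun p => t ^+ m S %| p)) => [||u uS].
- exact: dvdp0.
- by move=> *; exact: dvdp_add.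
by rewrite -dvd_m; have := no u; rewrite uS /=; have := mult_le_del uS; lia.
Qed.

Lemma hl_odd_l S u v : u \in S -> v \in S -> u != v ->
  odd (m (S :\ u) + m (S :\ v)) ->
  (m S + m (S :\ u :\ v) <= m (S :\ u) + m (S :\ v))%N.
Proof.
move=> uS vS uv; rewrite -!mupM //; apply: sosB_odd_mupl; rewrite ?mulf_neq0 //.
exact: (sos_hl_diff mf).
Qed.

Lemma hl_odd_r S u v : u \in S -> v \in S -> u != v ->
  odd (m S + m (S :\ u :\ v)) ->
  (m (S :\ u) + m (S :\ v) <= m S + m (S :\ u :\ v))%N.
Proof.
move=> uS vS uv; rewrite -!mupM //; apply: sosB_odd_mupr; rewrite ?mulf_neq0 //.
exact: (sos_hl_diff mf).
Qed.

Lemma dvd_hl_diff n S u v :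
  (n <= m (S :\ u) + m (S :\ v))%N -> (n <= m S + m (S :\ u :\ v))%N ->
  t ^+ n %| hl_diff f S u v.
Proof.
by rewrite -!mupM // => h1 h2; rewrite dvdp_sub // -mup_geq ?mulf_neq0.
Qed.

(** Serves where parity is silent: as squares cannot cancel, a lower bound on the orders of both
    products passes to the square of the edge term. *)
Lemma hl_edge n S u v : u \in S -> v \in S -> e u v ->
  (n <= m (S :\ u) + m (S :\ v))%N -> (n <= m S + m (S :\ u :\ v))%N ->
  (n <= (m (S :\ u :\ v)).*2)%N.
Proof.
move=> uS vS euv h1 h2.
have uv : u != v by apply: contraTneq euv => ->; rewrite e_irr.
have [q sos_q Eq] := hl_diff_edge mf uS vS uv euv.
have := dvd_hl_diff h1 h2; rewrite Eq => /(sosD_dvd (sos_sqr _) sos_q).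
by rewrite -mup_geq ?expf_neq0 // expr2 mupM // addnn.
Qed.

(** The first two bounds pass to the summand [hl_diff f (S :\ u) a v], and the third carries them
    over to the product subtracted in it. *)
Lemma hl_step n S u v a : u \in S -> v \in S -> u != v ->
  a \in S -> a != v -> e u a ->
  (n <= m (S :\ u) + m (S :\ v))%N -> (n <= m S + m (S :\ u :\ v))%N ->
  (n <= m (S :\ u :\ a) + m (S :\ u :\ v))%N ->
  (n <= m (S :\ u) + m (S :\ u :\ a :\ v))%N.
Proof.
move=> uS vS uv aS av eua h1 h2 h3.
have au : a != u by apply: contraTneq eua => ->; rewrite e_irr.
have [q sos_q Eq] := hl_diff_step mf uS vS uv aS au av eua.
have := dvd_hl_diff h1 h2; rewrite Eq => /sosD_dvd -/(_ _ sos_q).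
have sos_W : sos (hl_diff f (S :\ u) a v).
  by apply: (sos_hl_diff mf); rewrite // in_setD1 ?au // eq_sym uv.
move=> /(_ sos_W); rewrite /hl_diff dvdp_subr.
  by rewrite -mup_geq ?mulf_neq0 // mupM.
by rewrite -mup_geq ?mulf_neq0 // mupM.
Qed.

Lemma special_positive S a w : a \in S -> w \in S -> e a w ->
  (m (S :\ w)).+1 = m S -> (m (S :\ a)).+1 <> m S -> m (S :\ a) = (m S).+1.
Proof.
move=> aS wS eaw ess_w ness_a.
have aw : a != w by apply: contraTneq eaw => ->; rewrite e_irr.
have wSa : w \in S :\ a by rewrite in_setD1 eq_sym aw.
have := mult_le_del aS; have := mult_del_le aS; have := mult_le_del wSa.
(* If [a] were neutral, parity would give [S :\ a :\ w] multiplicity [m S - 1], too small for the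
   square of the edge term. *)
move=> h1 h2 h3; case: (eqVneq (m (S :\ a)) (m S)) => [Ea|]; last by lia.
have := hl_odd_l aS wS aw; have := @hl_edge (m (S :\ a) + m (S :\ w)) S a w aS wS eaw.
by lia.
Qed.

End Family.

(** * Stability and the transitivity step of Gallai's lemma *)

Lemma loop_in f a z S : a \in S -> loop f a z S = f S + z *: f (S :\ a).
Proof. by rewrite /loop => ->. Qed.

Lemma loop_notin f a z S : a \notin S -> loop f a z S = f S.
Proof. by rewrite /loop => /negbTE ->; rewrite addr0. Qed.

(** Otherwise [S :\ v] and [S :\ v :\ a] have equal multiplicity, and a loop at [a] raises that of
    [S :\ v] but not that of [S :\ v :\ w], against interlacing. *)
Lemma stability_neutral y f S a v w : matching_family e y f ->
  a \in S -> v \in S -> w \in S -> a != v -> e a w ->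
  (mup theta (f (S :\ w))).+1 = mup theta (f S) ->
  mup theta (f (S :\ a)) = (mup theta (f S)).+1 ->
  mup theta (f (S :\ v)) = mup theta (f S) ->
  mup theta (f (S :\ v :\ a)) = (mup theta (f (S :\ v))).+1.
Proof.
move=> mf aS vS wS av eaw Ew Ea Ev.
have aw : a != w by apply: contraTneq eaw => ->; rewrite e_irr.
have vw : v != w by apply/eqP => vw; move: Ev Ew; rewrite vw; mup_lia.
have aSv : a \in S :\ v by rewrite in_setD1 av.
have wSv : w \in S :\ v by rewrite in_setD1 eq_sym vw.
have vSw : v \in S :\ w by rewrite in_setD1 vw.
have aSw : a \in S :\ w by rewrite in_setD1 aw.
have vSa : v \in S :\ a by rewrite in_setD1 eq_sym av.
have wSa : w \in S :\ a by rewrite in_setD1 eq_sym aw.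
have aSvw : a \in S :\ v :\ w by rewrite in_setD1 aw.
have h1 := mult_le_del mf aSv; have h2 := mult_del_le mf aSv.
have h3 := mult_le_del mf vSa; rewrite setD1AC in h3.
case: (eqVneq (mup theta (f (S :\ v :\ a))) (mup theta (f (S :\ v)))) => [Eav|]; last by mup_lia.
have h4 := mult_le_del mf wSv; have h5 := mult_del_le mf vSw.
have h6 := hl_odd_l mf vS wS vw.
have Evw : (mup theta (f (S :\ v :\ w))).+1 = mup theta (f S) by mup_lia.
have h7 := mult_le_del mf wSa; have h8 := mult_del_le mf aSw.
rewrite [S :\ w :\ a]setD1AC in h8.
have Eaw : mup theta (f (S :\ a :\ w)) = mup theta (f S) by mup_lia.
have ewa : e w a by rewrite e_sym.
have wv : w != v by rewrite eq_sym.
(* Paths from [w] to [v] through [a] bound from below the multiplicity left after deleting all three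
   vertices. *)
have := @hl_step _ _ mf (mup theta (f S)+ mup theta (f (S :\ v :\ w)))%N S w v a wS vS wv aS av ewa.
rewrite [S :\ w :\ v]setD1AC [S :\ w :\ a]setD1AC [S :\ a :\ w :\ v]setD1AC.
rewrite [S :\ a :\ v]setD1AC [S :\ v :\ a :\ w]setD1AC => h9.
have Eavw : (mup theta (f S) <= mup theta (f (S :\ v :\ w :\ a)))%N by mup_lia.
(* A loop at [a] of suitable weight makes [v] positive, while [w] stays essential. *)
have [z] := @mup_cancel _ theta (f (S :\ v)) (f (S :\ v :\ a)) (mf_neq0 mf _)
  (mf_neq0 mf _) (esym Eav).
have mF := loop_family a z mf; have := mult_le_del mF wSv.
rewrite -loop_in // -mup_geq ?(mf_neq0 mF) // [loop f a z (S :\ v :\ w)]loop_in //.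
rewrite mup_addl ?(mf_neq0 mf) //; first by mup_lia.
by rewrite -mul_polyC dvdp_mull // -mup_geq ?(mf_neq0 mf) // Evw.
Qed.

(** Parity excludes that [a] is neutral in [S :\ v]; if it were essential there, a loop at [a] would
    reduce to [stability_neutral]. *)
Lemma stability_positive y f S a v w : matching_family e y f ->
  a \in S -> v \in S -> w \in S -> a != v -> e a w ->
  (mup theta (f (S :\ w))).+1 = mup theta (f S) ->
  mup theta (f (S :\ a)) = (mup theta (f S)).+1 ->
  mup theta (f (S :\ v)) = (mup theta (f S)).+1 ->
  mup theta (f (S :\ v :\ a)) = (mup theta (f (S :\ v))).+1.
Proof.
move=> mf aS vS wS av eaw Ew Ea Ev.
have aw : a != w by apply: contraTneq eaw => ->; rewrite e_irr.
have aSv : a \in S :\ v by rewrite in_setD1 av.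
have aSw : a \in S :\ w by rewrite in_setD1 aw.
have wSa : w \in S :\ a by rewrite in_setD1 eq_sym aw.
have h1 := mult_le_del mf aSv; have h2 := mult_del_le mf aSv.
have h3 := hl_odd_r mf aS vS av; rewrite setD1AC in h3.
case: (eqVneq (mup theta (f (S :\ v :\ a))) (mup theta (f S))) => [Eav|]; last by mup_lia.
have h7 := mult_le_del mf wSa; rewrite setD1AC in h7.
(* A loop at [a] makes [v] neutral. *)
have mF := loop_family a 1 mf.
have FS : mup theta (loop f a 1 S) = mup theta (f S).
  by rewrite loop_in // scale1r mup_addl ?(mf_neq0 mf) // -mup_geq ?(mf_neq0 mf) //; mup_lia.
have Fa : loop f a 1 (S :\ a) = f (S :\ a) by rewrite loop_notin // setD11.
have Fw : mup theta (loop f a 1 (S :\ w)) = mup theta (f (S :\ w)).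
  by rewrite loop_in // scale1r mup_addl ?(mf_neq0 mf) // -mup_geq ?(mf_neq0 mf) //; mup_lia.
have Fv : mup theta (loop f a 1 (S :\ v)) = mup theta (f S).
  rewrite loop_in // scale1r addrC mup_addl ?(mf_neq0 mf) //.
  by rewrite -mup_geq ?(mf_neq0 mf) //; mup_lia.
have := stability_neutral mF aS vS wS av eaw.
rewrite FS Fa Fw Fv loop_notin ?setD11 //; by mup_lia.
Qed.

(** The case of an essential [v] follows from interlacing alone. *)
Lemma stability y f S a v w : matching_family e y f ->
  a \in S -> v \in S -> w \in S -> a != v -> e a w ->
  (mup theta (f (S :\ w))).+1 = mup theta (f S) ->
  (mup theta (f (S :\ a))).+1 <> mup theta (f S) ->
  mup theta (f (S :\ v :\ a)) = (mup theta (f (S :\ v))).+1.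
Proof.
move=> mf aS vS wS av eaw Ew Ea.
have Pa := special_positive mf aS wS eaw Ew Ea.
have aSv : a \in S :\ v by rewrite in_setD1 av.
have vSa : v \in S :\ a by rewrite in_setD1 eq_sym av.
have h1 := mult_le_del mf vS; have h2 := mult_del_le mf vS.
have h3 := mult_del_le mf aSv; have h4 := mult_le_del mf vSa.
rewrite setD1AC in h4.
have := stability_neutral mf aS vS wS av eaw Ew Pa.
have := stability_positive mf aS vS wS av eaw Ew Pa.
mup_lia.
Qed.

(** Were the claim false, [S] and [S :\ u :\ w] would have multiplicities [k] and [k - 2], of even
    sum. A loop at [v] lowers only the first by one, and the odd sum contradicts [hl_odd_r]. *)
Lemma gallai_trans y f S u v w : matching_family e y f ->
  u \in S -> v \in S -> w \in S -> u != v -> v != w -> u != w ->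
  (mup theta (f (S :\ u))).+1 = mup theta (f S) ->
  (mup theta (f (S :\ v))).+1 = mup theta (f S) ->
  (mup theta (f (S :\ w))).+1 = mup theta (f S) ->
  (mup theta (f S) <= (mup theta (f (S :\ u :\ v))).+1)%N ->
  (mup theta (f S) <= (mup theta (f (S :\ v :\ w))).+1)%N ->
  (mup theta (f S) <= (mup theta (f (S :\ u :\ w))).+1)%N.
Proof.
move=> mf uS vS wS uv vw uw Eu Ev Ew luv lvw; rewrite leqNgt; apply/negP => ltuw.
have vSu : v \in S :\ u by rewrite in_setD1 eq_sym uv.
have vSw : v \in S :\ w by rewrite in_setD1 vw.
have wSu : w \in S :\ u by rewrite in_setD1 eq_sym uw.
have vSuw : v \in S :\ u :\ w by rewrite in_setD1 vw.
have h1 := mult_le_del mf wSu.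
set k := mup theta (f S) in Eu Ev Ew luv lvw ltuw *.
have f0 := mf_neq0 mf.
(* Weights 1 and 2 cannot both raise the order at [S :\ u :\ w], since [f] there is a combination of
   the two loop polynomials. *)
have [z z0 nd] : exists2 z : R, z != 0 & ~~ (t ^+ k.-1 %| loop f v z (S :\ u :\ w)).
  have [d1|] := boolP (t ^+ k.-1 %| loop f v 1 (S :\ u :\ w)); last by exists 1; rewrite ?oner_eq0.
  exists 2; first by rewrite pnatr_eq0.
  apply/negP => d2; suff: t ^+ k.-1 %| f (S :\ u :\ w) by rewrite -mup_geq //; mup_lia.
  have -> : f (S :\ u :\ w) = 2 * loop f v 1 (S :\ u :\ w) - loop f v 2 (S :\ u :\ w).
    by rewrite !loop_in // -!mul_polyC polyC1 -[2%:P]/(2%:R%:P) polyC_natr; ring.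
  by rewrite dvdp_sub // dvdp_mull.
have mF := loop_family v z mf; have F0 := mf_neq0 mF.
have FS : (mup theta (loop f v z S)).+1 = k.
  rewrite loop_in // addrC mup_addl; first by rewrite -mul_polyC mupMr ?rootC.
    by rewrite scaler_eq0 negb_or z0 f0.
  by rewrite -mul_polyC mupMr ?rootC // Ev -mup_geq.
have le_loop S' : v \in S' -> (k <= (mup theta (f S')).+1)%N ->
    (k <= (mup theta (f (S' :\ v))).+1)%N -> (k.-1 <= mup theta (loop f v z S'))%N.
  move=> vS' g1 g2; rewrite mup_geq // loop_in // dvdp_add //.
    by rewrite -mup_geq //; mup_lia.
  by rewrite dvdpZr // -mup_geq //; mup_lia.
have Fu := le_loop _ vSu; have Fw := le_loop _ vSw.
rewrite [S :\ w :\ v]setD1AC in Fw.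
have h2 := mult_le_del mF uS; have h3 := mult_le_del mF wSu.
have := hl_odd_r mF uS wS uw; move: nd; rewrite -mup_geq //; mup_lia.
Qed.

End Multiplicity.

(** * The matching polynomial *)

Section MatchingRecurrence.

Variables (R : realType) (T : finType) (e : rel T).
Hypotheses (e_sym : symmetric e) (e_irr : irreflexive e).
Implicit Types (S A : {set T}) (M : {set {set T}}).

Lemma edgesP S A : reflect
  (exists x y, [/\ x \in S, y \in S, e x y & A = [set x; y]]) (A \in edges e S).
Proof.
rewrite inE; apply: (iffP exists_inP) => [[x xS /exists_inP[y yS /andP[exy /eqP]]]|].
  by exists x, y.
move=> [x [y [xS yS exy ->]]]; exists x => //; apply/exists_inP; exists y => //.
by rewrite exy eqxx.
Qed.

Lemma card_edge S A : A \in edges e S -> #|A| = 2.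
Proof.
case/edgesP=> x [y [_ _ exy ->]]; rewrite cards2.
by rewrite (contraTneq _ exy) // => ->; rewrite e_irr.
Qed.

Lemma edge_sub S A : A \in edges e S -> A \subset S.
Proof. by case/edgesP=> x [y [xS yS _ ->]]; rewrite subUset !sub1set xS. Qed.

Lemma edgesD1 S u A : (A \in edges e (S :\ u)) = (A \in edges e S) && (u \notin A).
Proof.
apply/edgesP/andP => [[x [y []]]|[/edgesP[x [y [xS yS exy ->]]]]].
  rewrite !in_setD1 => /andP[xu xS] /andP[yu yS] exy ->; split.
    by apply/edgesP; exists x, y.
  by rewrite !inE negb_or ![u == _]eq_sym xu.
rewrite !inE negb_or ![u == _]eq_sym => /andP[xu yu].
by exists x, y; rewrite !in_setD1 xu yu.
Qed.

Lemma edge_at S u A : A \in edges e S -> u \in A ->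
  exists2 i, (i \in S :\ u) && e u i & A = [set u; i].
Proof.
case/edgesP=> x [y [xS yS exy ->]].
have xy : x != y by apply: contraTneq exy => ->; rewrite e_irr.
rewrite !inE => /orP[]/eqP->; first by exists y; rewrite // in_setD1 eq_sym xy yS.
by exists x; rewrite 1?setUC // in_setD1 xy xS e_sym.
Qed.

Lemma card_matching S M : is_matching e S M -> (2 * #|M| <= #|S|)%N.
Proof.
case/andP=> sM /eqP tM; have -> : (2 * #|M|)%N = #|cover M|.
  rewrite -tM -sum1_card big_distrr /=; apply: eq_bigr => A AM.
  by rewrite muln1 (card_edge (subsetP sM A AM)).
by apply/subset_leq_card/bigcupsP => A AM; apply/edge_sub/(subsetP sM).
Qed.

(** A sum over matchings, unlike one over sizes, can be split by how a vertex is covered. *)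
Lemma matching_polyE S : matching_poly R e S =
  \sum_(M | is_matching e S M) (-1) ^+ #|M| *: 'X^(#|S| - 2 * #|M|).
Proof.
have ltM M : is_matching e S M -> (#|M| < (#|S| %/ 2).+1)%N.
  by move=> /card_matching; lia.
rewrite (partition_big (fun M => inord #|M| : 'I_(#|S| %/ 2).+1) xpredT) //.
apply: eq_bigr => r _; rewrite /num_matchings -sum1dep_card natr_sum.
rewrite mulr_sumr scaler_suml; apply: eq_big => [M|M].
  apply: andb_id2l => /ltM lt.
  by rewrite -val_eqE /= inordK.
by move=> /andP[_ /eqP->]; rewrite mulr1.
Qed.

Lemma is_matchingD1 S u M :
  is_matching e (S :\ u) M = is_matching e S M && (u \notin cover M).
Proof.
rewrite /is_matching andbAC; congr (_ && _); apply/subsetP/andP.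
  move=> sM; split; first by apply/subsetP => A /sM; rewrite edgesD1 => /andP[].
  apply/bigcupP => -[A /sM]; rewrite edgesD1 => /andP[_ /negP uA] //.
case=> /subsetP sM uM A AM; rewrite edgesD1 sM //=.
by apply: contra uM => uA; apply/bigcupP; exists A.
Qed.

Lemma is_matchingU1 S u i M : u \in S -> i \in S :\ u -> e u i ->
  is_matching e S ([set u; i] |: M) && ([set u; i] \notin M) =
  is_matching e (S :\ u :\ i) M.
Proof.
rewrite in_setD1 => uS /andP[iu iS] eui; rewrite !is_matchingD1 -andbA -negb_or.
have EE : [set u; i] \in edges e S by apply/edgesP; exists u, i.
apply/andP/andP => -[]; rewrite /is_matching subUset sub1set EE /=.
  move=> /andP[sM tM] nM; split.
    by rewrite sM; apply: trivIsetS tM; exact: subsetUr.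
  have dis A : A \in M -> [disjoint [set u; i] & A].
    move=> AM; apply: (trivIsetP tM); rewrite ?setU11 ?setU1r //.
    by apply: contraNneq nM => ->.
  apply/norP; split; apply/bigcupP => -[A /dis dA].
    by rewrite (disjointFr dA) // !inE eqxx.
  by rewrite (disjointFr dA) // !inE eqxx orbT.
move=> /andP[sM tM]; rewrite negb_or => /andP[uM iM].
have nA A : A \in M -> (u \notin A) && (i \notin A).
  move=> AM; apply/andP; split; [move: uM | move: iM]; apply: contra => ?;
  by apply/bigcupP; exists A.
have dis A : A \in M -> [disjoint [set u; i] & A].
  by move=> /nA/andP[uA iA]; rewrite disjoints_subset subUset !sub1set !inE uA.
split; last by apply: contraT => /negPn/nA; rewrite !inE eqxx.
rewrite sM /=; apply/trivIsetP => A B /setU1P[->|AM] /setU1P[->|BM] AB.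
- by rewrite eqxx in AB.
- exact: dis.
- by rewrite disjoint_sym dis.
- exact: (trivIsetP tM).
Qed.

Lemma matching_at S u i j M : is_matching e S M -> i != u -> 
  [set u; i] \in M -> [set u; j] \in M -> i = j.
Proof.
case/andP=> _ tM iu iM jM; apply/eqP; apply: contraT => ij.
have : [disjoint [set u; i] & [set u; j]].
  apply: (trivIsetP tM) => //; apply: contraNneq ij => /setP/(_ i).
  by rewrite !inE eqxx orbT (negbTE iu) /= => /esym.
by move=> dj; have := disjointFr dj (set21 u i); rewrite !inE eqxx.
Qed.

(** Matchings that avoid [u] give the first term; the others are grouped by the partner of [u], and
    removing that edge changes the sign. *)
Lemma matching_poly_family : matching_family e (fun=> 0) (matching_poly R e).
Proof.
split=> [|S u uS].
  rewrite matching_polyE (big_pred1 set0) ?cards0 ?expr0 ?scale1r // => M.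
  apply/idP/eqP => [/card_matching|->]; last first.
    by rewrite /is_matching sub0set; apply/trivIsetP => A B; rewrite inE.
  by rewrite cards0 => cM; apply: cards0_eq; lia.
have cS : #|S| = #|S :\ u|.+1 by rewrite (cardsD1 u) uS.
rewrite subr0 !matching_polyE (bigID (fun M => u \notin cover M)) /=.
congr (_ + _).
  rewrite mulr_sumr; apply: eq_big => [M|M]; rewrite -is_matchingD1 //.
  move=> /card_matching cM; rewrite -scalerAr -exprS cS subSn //.
(* The partner of [u] in [M]; the default [u] never occurs for a matching that covers [u]. *)
pose p M := odflt u [pick i | [&& i \in S :\ u, e u i & [set u; i] \in M]].
have pP M : is_matching e S M && ~~ (u \notin cover M) ->
    [&& p M \in S :\ u, e u (p M) & [set u; p M] \in M].
  move=> /andP[/andP[sM _] /negPn/bigcupP[A AM uA]].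
  rewrite /p; case: pickP => //= no.
  have [i /andP[iS eui] EA] := edge_at (subsetP sM A AM) uA.
  by have := no i; rewrite iS eui -EA AM.
rewrite (partition_big p [pred i | (i \in S :\ u) && e u i]) /=; last first.
  by move=> M /pP/and3P[-> ->].
rewrite -sumrN; apply: eq_bigr => i /andP[iS eui].
have iu : i != u by move: iS; rewrite in_setD1 => /andP[].
rewrite (eq_bigl (fun M => is_matching e S M && ([set u; i] \in M))); last first.
  move=> M; apply/andP/andP => [[mM /eqP <-]|[mM iM]].
    by have /and3P[_ _ ->] := pP _ mM; case/andP: mM.
  have uM : u \in cover M by apply/bigcupP; exists [set u; i]; rewrite // !inE eqxx.
  have cM : is_matching e S M && ~~ (u \notin cover M) by rewrite mM negbK.
  by split=> //; have /and3P[_ _ pM] := pP _ cM; apply/eqP/esym/(matching_at mM iu iM pM).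
rewrite (reindex_onto (fun M => [set u; i] |: M) (fun M => M :\ [set u; i])) /=; last first.
  by move=> M /andP[_ iM]; rewrite setD1K.
rewrite matching_polyE -sumrN; apply: eq_big => M.
  rewrite setU11 andbT -(is_matchingU1 _ uS iS eui); congr (_ && _).
  by apply/eqP/idP => [<-|nM]; rewrite ?setD11 // setU1K.
move=> /andP[/andP[_ _] /eqP EM].
have nM : [set u; i] \notin M by rewrite -EM setD11.
rewrite cardsU1 nM add1n exprS mulN1r scaleNr; congr (- (_ *: 'X^_)).
by rewrite cS (cardsD1 i (S :\ u)) iS; lia.
Qed.

End MatchingRecurrence.

(** * The Gallai-Edmonds structure and barrier sets *)

Section Components.

Variables (T : finType) (e : rel T).
Hypothesis e_sym : symmetric e.
Implicit Types (S C : {set T}) (u v w a : T).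

Lemma connect_induced_equiv S :
  {in S & &, equivalence_rel (connect (induced_rel e S))}.
Proof.
have sym : connect_sym (induced_rel e S).
  by apply: sym_connect_sym => x y; rewrite /induced_rel /= e_sym andbCA.
by move=> x y z _ _ _; split=> [|xy]; [exact: connect0 | exact: (same_connect sym xy)].
Qed.

Lemma partition_components S : partition (components e S) S.
Proof. exact: equivalence_partitionP (@connect_induced_equiv S). Qed.

Lemma component_sub S C : C \in components e S -> C \subset S.
Proof.
move=> CP; rewrite -(cover_partition (partition_components S)).
exact: bigcup_sup.
Qed.

Lemma component_connect S C u v : C \in components e S -> u \in C -> v \in S ->
  (v \in C) = connect (induced_rel e S) u v.
Proof.
move=> CP uC vS; have uS := subsetP (component_sub CP) _ uC.
rewrite -(pblock_equivalence_partition (@connect_induced_equiv S) uS vS).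
by rewrite (def_pblock _ CP uC) //; case/and3P: (partition_components S).
Qed.

Lemma component_edge S C u v : C \in components e S -> u \in C -> v \in S ->
  e u v -> v \in C.
Proof.
move=> CP uC vS euv; rewrite (component_connect CP uC vS); apply: connect1.
by rewrite /induced_rel /= (subsetP (component_sub CP) _ uC) vS.
Qed.

Lemma component_ind S C (P : pred T) u : C \in components e S -> u \in C -> P u ->
  (forall x y, x \in C -> y \in C -> e x y -> P x -> P y) ->
  forall v, v \in C -> P v.
Proof.
move=> CP uC Pu step v vC.
have vS := subsetP (component_sub CP) _ vC.
have := vC; rewrite (component_connect CP uC vS) => /connectP[p].
elim: p u uC Pu => [|x p IHp] u uC Pu /=; first by move=> _ ->.
case/andP=> /and3P[uS xS eux] pxp Ev.
have xC := component_edge CP uC xS eux.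
exact: IHp xC (step _ _ uC xC eux Pu) pxp Ev.
Qed.

Lemma component_exists S u : u \in S -> exists2 C, C \in components e S & u \in C.
Proof.
by rewrite -{1}(cover_partition (partition_components S)) => /bigcupP[C]; exists C.
Qed.

Lemma component_eq S B C u : B \in components e S -> C \in components e S ->
  u \in B -> u \in C -> B = C.
Proof.
have /and3P[_ tP _] := partition_components S => BP CP uB uC.
by rewrite -(def_pblock tP BP uB) (def_pblock tP CP uC).
Qed.

End Components.

(** * Multiplicities of components and Gallai's lemma *)

Section GallaiEdmonds.

Variables (R : realType) (T : finType) (e : rel T) (theta : R).
Hypotheses (e_sym : symmetric e) (e_irr : irreflexive e).
Implicit Types (S X C : {set T}) (u v w a : T).
Local Notation m S := (mult e theta S).

Let mf := matching_poly_family R e_sym e_irr.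

Lemma matching_polyU S S' : [disjoint S & S'] ->
  (forall u v, u \in S -> v \in S' -> ~~ e u v) ->
  matching_poly R e (S :|: S') = matching_poly R e S * matching_poly R e S'.
Proof.
have [n leS] := ubnP #|S|; elim: n => // n IHn in S leS *.
move=> dS noE; have [->|[u uS]] := set_0Vmem S.
  by rewrite set0U; case: mf => ->; rewrite mul1r.
have cS : #|S| = #|S :\ u|.+1 by rewrite (cardsD1 u) uS.
have uS' : u \notin S' by rewrite (disjointFr dS uS).
have ED S1 i : i \notin S' -> (S1 :|: S') :\ i = (S1 :\ i) :|: S'.
  by move=> iS'; rewrite setDUl (setD1_notin iS').
have IH S1 : S1 \subset S :\ u -> matching_poly R e (S1 :|: S') =
    matching_poly R e S1 * matching_poly R e S'.
  move=> sS1; have sS : S1 \subset S := subset_trans sS1 (subD1set S u).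
  apply: IHn; first by have := subset_leq_card sS1; lia.
    exact: disjointWl dS.
  by move=> v w vS1; apply: noE; exact: (subsetP sS).
rewrite (mf_rec mf (_ : u \in S :|: S')) ?inE ?uS // (mf_rec mf uS) ED // IH //.
rewrite [RHS]mulrBl mulrA; congr (_ - _); rewrite mulr_suml.
rewrite (eq_bigl (fun i => (i \in S :\ u) && e u i)) => [|i].
  apply: eq_bigr => i /andP[iSu _].
  have iS' : i \notin S' by rewrite (disjointFr dS) //; move: iSu; rewrite inE => /andP[].
  by rewrite ED // IH // subD1set.
rewrite !inE; case: (boolP (i \in S')) => [iS'|]; last by rewrite orbF.
by rewrite (negbTE (noE _ _ uS iS')) !andbF.
Qed.

Lemma mult_setU S S' : [disjoint S & S'] ->
  (forall u v, u \in S -> v \in S' -> ~~ e u v) -> m (S :|: S') = (m S + m S')%N.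
Proof.
by move=> dS noE; rewrite /mult matching_polyU // mupM ?(mf_neq0 mf).
Qed.

Lemma mult_set0 : m set0 = 0%N.
Proof. by rewrite /mult; case: mf => -> _; rewrite mupNroot ?root1. Qed.

Lemma mult_le_D1 S u : u \in S -> (m S <= (m (S :\ u)).+1)%N.
Proof. exact: (mult_le_del theta mf). Qed.

Lemma mult_D1_le S u : u \in S -> (m (S :\ u) <= (m S).+1)%N.
Proof. exact: (mult_del_le theta mf). Qed.

Lemma mult_edge n S u v : u \in S -> v \in S -> e u v ->
  (n <= m (S :\ u) + m (S :\ v))%N -> (n <= m S + m (S :\ u :\ v))%N ->
  (n <= (m (S :\ u :\ v)).*2)%N.
Proof. exact: (hl_edge e_irr mf). Qed.

Lemma mult_gt0_essential S : (0 < m S)%N ->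
  exists2 u, u \in S & (m (S :\ u)).+1 = m S.
Proof. exact: (exists_essential mf). Qed.

Lemma mult_components S : m S = (\sum_(C in components e S) m C)%N.
Proof.
rewrite -{1}(cover_partition (partition_components e_sym S)).
(* The induction needs an arbitrary subfamily [Q] of the components. *)
have := subxx (components e S); move: {1 3 4}(components e S) => Q.
have [n leQ] := ubnP #|Q|; elim: n => // n IHn in Q leQ *.
have [->|[C CQ]] := set_0Vmem Q; first by rewrite /cover !big_set0 mult_set0.
move=> sQ; rewrite /cover !(big_setD1 C CQ) /= mult_setU.
- rewrite -/(cover (Q :\ C)) IHn //.
    by rewrite (cardsD1 C) CQ in leQ; lia.
  exact: subset_trans (subD1set _ _) sQ.
- rewrite disjoints_subset; apply/subsetP => x xC; rewrite inE.
  apply/bigcupP => -[B]; rewrite in_setD1 => /andP[BC BQ] xB.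
  case/eqP: BC.
  exact: (component_eq e_sym (subsetP sQ _ BQ) (subsetP sQ _ CQ) xB xC).
move=> x y xC /bigcupP[B]; rewrite in_setD1 => /andP[BC BQ] yB.
have BP := subsetP sQ _ BQ; have CP := subsetP sQ _ CQ.
apply: contra BC => exy; apply/eqP/(component_eq e_sym BP CP yB).
by apply: (component_edge e_sym CP xC) exy; apply: (subsetP (component_sub e_sym BP)).
Qed.

(** [S :\: C] contributes the same amount before and after the deletion; the additive form avoids
    truncated subtraction. *)
Lemma mult_component_del S C u : C \in components e S -> u \in C ->
  (m (S :\ u) + m C = m S + m (C :\ u))%N.
Proof.
move=> CP uC; have sCS := component_sub e_sym CP.
have split C' : C' \subset C -> m (C' :|: S :\: C) = (m C' + m (S :\: C))%N.
  move=> sC'; apply: mult_setU.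
    apply: disjointWl sC' _; rewrite disjoints_subset; apply/subsetP => x xC.
    by rewrite !inE xC.
  move=> x y xC'; rewrite inE => /andP[yC yS]; apply: contra yC.
  exact: (component_edge e_sym CP (subsetP sC' _ xC')).
have E1 : S = C :|: S :\: C by rewrite setDE setUIr setUCr setIT; apply/esym/setUidPr.
have E2 : S :\ u = (C :\ u) :|: S :\: C.
  rewrite {1}E1 setDUl; congr (_ :|: _); apply: setD1_notin.
  by rewrite inE uC.
by rewrite E2 {2}E1 !split ?subD1set //; mup_lia.
Qed.

Lemma essential_component S C u : C \in components e S -> u \in C ->
  essential e theta S u = essential e theta C u.
Proof.
move=> CP uC; rewrite /essential uC (subsetP (component_sub e_sym CP)) //=.
have h := mult_component_del CP uC; apply/eqP/eqP; mup_lia.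
Qed.

(** Only the value [m S - 2] is to be excluded: both products would then vanish to order
    [2 * m S - 2], but the square of the edge term would not. *)
Lemma gallai_edge S u v : u \in S -> v \in S -> e u v ->
  essential e theta S u -> essential e theta S v -> (m S <= (m (S :\ u :\ v)).+1)%N.
Proof.
move=> uS vS euv /andP[_ /eqP Eu] /andP[_ /eqP Ev].
have uv : u != v by apply: contraTneq euv => ->; rewrite e_irr.
have vSu : v \in S :\ u by rewrite in_setD1 eq_sym uv.
have h1 := mult_le_D1 vSu.
have h2 := mult_edge uS vS euv (leqnn _).
mup_lia.
Qed.

(** The relation behind [P] holds along edges and is transitive, so connectivity extends it to all
    pairs. An essential vertex of [C :\ u] would violate it, so [m (C :\ u)] is 0. *)
Lemma gallai S C : C \in components e S -> C != set0 ->
  {in C, forall u, essential e theta C u} -> m C = 1%N.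
Proof.
move=> CP /set0Pn[u uC] ess.
have E v : v \in C -> (m (C :\ v)).+1 = m C by move=> /ess/andP[_ /eqP].
pose P v := (v == u) || (m C <= (m (C :\ u :\ v)).+1)%N.
have allP : forall v, v \in C -> P v.
  apply: (component_ind e_sym CP uC); first by rewrite /P eqxx.
  move=> x y xC yC exy; rewrite /P; have [//|yu] := eqVneq y u.
  have [Exu|xu] := eqVneq x u; first by subst x => _; apply: gallai_edge; rewrite ?ess.
  have xy : x != y by apply: contraTneq exy => ->; rewrite e_irr.
  move=> /= Px; apply: (gallai_trans mf uC xC yC _ xy _ (E _ uC) (E _ xC) (E _ yC) Px).
  - by rewrite eq_sym.
  - by rewrite eq_sym.
  by apply: gallai_edge; rewrite ?ess.
have Eu := E _ uC; rewrite -Eu; congr _.+1; apply/eqP; rewrite -leqn0 leqNgt.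
apply/negP => /mult_gt0_essential[v vC].
move: vC; rewrite in_setD1 => /andP[vu /allP]; rewrite /P (negbTE vu) /=; mup_lia.
Qed.

(** * Deletion of special vertices *)

Lemma mult_special S a : special e theta S a -> m (S :\ a) = (m S).+1.
Proof.
case/and3P=> aS; rewrite /essential aS /= => /eqP na /existsP[w].
case/and3P=> wS eaw /andP[_ /eqP Ew].
exact: (special_positive e_irr mf aS wS eaw Ew na).
Qed.

(** Deleting [a] raises the multiplicities of [S] and [S :\ v] alike by one, the latter by
    [stability]. *)
Lemma essential_del_special S a : special e theta S a ->
  essential e theta (S :\ a) =1 essential e theta S.
Proof.
move=> sa v; have Pa := mult_special sa.
case/and3P: sa => aS na /existsP[w /and3P[wS eaw /andP[_ /eqP Ew]]].
have [->|va] := eqVneq v a; first by rewrite (negbTE na) /essential setD11.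
rewrite /essential in_setD1 va /=; case: (boolP (v \in S)) => //= vS.
rewrite /essential aS /= in na.
have av : a != v by rewrite eq_sym.
have stab : m (S :\ v :\ a) = (m (S :\ v)).+1.
  exact: (stability e_sym e_irr mf aS vS wS av eaw Ew (elimN eqP na)).
rewrite setD1AC stab.
by rewrite Pa eqSS.
Qed.

Lemma A_set_del_special S a : special e theta S a ->
  A_set e theta (S :\ a) = A_set e theta S :\ a.
Proof.
move=> sa; have ess := essential_del_special sa; apply/setP => v.
rewrite in_setD1 !inE /special in_setD1 ess -andbA; congr [&& _, _, _ & _].
apply: eq_existsb => w; rewrite in_setD1 ess.
have [->|//] := eqVneq w a; case/and3P: sa => _ /negbTE -> _.
by rewrite !andbF.
Qed.

Lemma A_set_sub S : A_set e theta S \subset S.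
Proof. by apply/subsetP => a; rewrite inE => /and3P[]. Qed.

Lemma del_special_set S X : X \subset A_set e theta S ->
  [/\ m (S :\: X) = (m S + #|X|)%N,
      essential e theta (S :\: X) =1 essential e theta S
    & A_set e theta (S :\: X) = A_set e theta S :\: X].
Proof.
have [n leX] := ubnP #|X|; elim: n => // n IHn in X leX *.
have [->|[x xX]] := set_0Vmem X; first by rewrite !setD0 cards0 addn0.
have cX : #|X| = #|X :\ x|.+1 by rewrite (cardsD1 x) xX.
have DX S1 : S1 :\: X = S1 :\: (X :\ x) :\ x by rewrite setDDl setUC setD1K.
move=> sX; case: (IHn (X :\ x)) => [||E1 E2 E3].
- by lia.
- exact: subset_trans (subD1set _ _) sX.
have sx : special e theta (S :\: (X :\ x)) x.
  suff: x \in A_set e theta (S :\: (X :\ x)) by rewrite inE.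
  by rewrite E3 in_setD setD11 (subsetP sX).
split; first by rewrite DX (mult_special sx) E1 cX addnS.
  by move=> v; rewrite DX (essential_del_special sx) E2.
by rewrite !DX (A_set_del_special sx) E3.
Qed.

(** Without special vertices essentiality spreads along edges: a component is all essential, hence
    critical by [gallai], or has no essential vertex and multiplicity 0. *)
Lemma mult_component_no_special S C : A_set e theta S = set0 ->
  C \in components e S -> m C = critical e theta C.
Proof.
move=> A0 CP; have sCS := component_sub e_sym CP.
have [/existsP[u /andP[uC eu]]|] := boolP [exists u, (u \in C) && essential e theta S u].
  have ess : {in C, forall v, essential e theta C v}.
    move=> v vC; rewrite -(essential_component CP vC).
    apply: (component_ind e_sym CP uC eu) vC => x y xC yC exy ex.
    apply: contraT => ney; have : y \in A_set e theta S; last by rewrite A0 inE.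
    rewrite inE /special ney (subsetP sCS) //=; apply/existsP; exists x.
    by rewrite (subsetP sCS) // e_sym exy.
  have m1 : m C = 1%N by apply: gallai CP _ ess; apply/set0Pn; exists u.
  have -> // : critical e theta C = true.
  by rewrite /critical m1 eqxx andbT; apply/forallP => v; apply/implyP/ess.
move=> no; have m0 : m C = 0%N.
  apply/eqP; rewrite -leqn0 leqNgt; apply: contra no => /mult_gt0_essential[u uC Eu].
  by apply/existsP; exists u; rewrite uC (essential_component CP uC) /essential uC; apply/eqP.
by rewrite /critical m0 andbF.
Qed.

(** * Critical components and barrier sets *)

Lemma num_criticalE S :
  num_critical e theta S = (\sum_(C in components e S) critical e theta C)%N.
Proof.
by rewrite /num_critical -sum1dep_card big_mkcondr; apply: eq_bigr => C _; case: critical.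
Qed.

Lemma critical_le_mult C : (critical e theta C <= m C)%N.
Proof. by case cC: (critical e theta C) => //; case/andP: cC => _ /eqP ->. Qed.

Lemma num_critical_leqif S : (num_critical e theta S <= m S ?= iff
  [forall (C | C \in components e S), m C == critical e theta C :> nat])%N.
Proof.
rewrite num_criticalE mult_components; apply: leqif_sum => C _.
by split; [exact: critical_le_mult | rewrite eq_sym].
Qed.

Lemma mult_setD_le S X : X \subset S -> (m (S :\: X) <= m S + #|X|)%N.
Proof.
have [n leX] := ubnP #|X|; elim: n => // n IHn in X leX *.
have [->|[x xX]] := set_0Vmem X; first by rewrite setD0 cards0 addn0.
have cX : #|X| = #|X :\ x|.+1 by rewrite (cardsD1 x) xX.
move=> sX; have -> : S :\: X = S :\: (X :\ x) :\ x by rewrite setDDl setUC setD1K.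
have xS : x \in S :\: (X :\ x) by rewrite in_setD setD11 (subsetP sX).
have := mult_D1_le xS.
have h : (#|X :\ x| < n)%N by clear -cX leX; lia.
by move: cX (IHn _ h (subset_trans (subD1set _ _) sX)); mup_lia.
Qed.

(** The number of critical components of [S :\: X] is at most [m (S :\: X)], which is at most
    [m S + #|X|]; a barrier makes both bounds tight. *)
Lemma barrierP S X : reflect
  [/\ X \subset S, m (S :\: X) = (m S + #|X|)%N
    & {in components e (S :\: X), forall C, m C = critical e theta C}]
  (barrier e theta S X).
Proof.
apply: (iffP andP) => [[sX /eqP bX]|[sX mX comp]].
  have [le iffE] := num_critical_leqif (S :\: X).
  have le2 := mult_setD_le sX.
  have Eeq : num_critical e theta (S :\: X) = m (S :\: X) by lia.
  move: iffE; rewrite Eeq eqxx => /esym/forall_inP comp.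
  by split=> [//||C /comp/eqP //]; lia.
have [_ iffE] := num_critical_leqif (S :\: X).
have /eqP : num_critical e theta (S :\: X) == m (S :\: X).
  by rewrite iffE; apply/forall_inP => C /comp ->.
by split=> //; apply/eqP; lia.
Qed.

Lemma barrier_A_set S : barrier e theta S (A_set e theta S).
Proof.
have [mA _ AA] := del_special_set (subxx (A_set e theta S)).
apply/barrierP; split=> [|//|C]; first exact: A_set_sub.
by apply: mult_component_no_special; rewrite AA setDv.
Qed.

(** Deleting [X] gains [#|X|] while each vertex gains at most one, so deleting [x] first must gain
    one. *)
Lemma barrier_positive S X x : barrier e theta S X -> x \in X ->
  positive e theta S x.
Proof.
case/barrierP=> sX mX _ xX; have xS := subsetP sX _ xX.
have ES : S :\: X = S :\ x :\: (X :\ x) by rewrite setDDl setD1K.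
have sX1 : X :\ x \subset S :\ x by exact: setSD.
have := mult_setD_le sX1; rewrite -ES mX (cardsD1 x) xX.
have := mult_D1_le xS; rewrite /positive xS /=.
by move=> h1 h2; apply/eqP; mup_lia.
Qed.

(** Members of [X] are positive, hence special. A special [a] outside [X] would share a component of
    [S :\: X] with an essential neighbour; that component is then critical, making [a] essential. *)
Lemma barrier_unique S X : P_set e theta S = set0 -> barrier e theta S X ->
  X = A_set e theta S.
Proof.
move=> P0 bX; have sXA : X \subset A_set e theta S.
  apply/subsetP => x xX; apply: contraT => nA.
  have : x \in P_set e theta S by rewrite inE nA (barrier_positive bX xX).
  by rewrite P0 inE.
have [_ ess _] := del_special_set sXA.
have [sX _ comp] := barrierP _ _ bX.
apply/eqP; rewrite eqEsubset sXA; apply/subsetP => a; rewrite inE.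
case/and3P=> aS na /existsP[w /and3P[wS eaw ew]]; apply: contraT => aX.
have aSX : a \in S :\: X by rewrite inE aX.
have ew' : essential e theta (S :\: X) w by rewrite ess.
have wSX : w \in S :\: X by case/andP: ew'.
have [C CP aC] := component_exists e_sym aSX.
have wC := component_edge e_sym CP aC wSX eaw.
have := comp _ CP; move: ew'; rewrite (essential_component CP wC).
case/andP=> _ /eqP <-; case cC: (critical e theta C) => // _.
case/andP: cC => /forall_inP/(_ a aC); rewrite -(essential_component CP aC) ess.
by rewrite (negbTE na).
Qed.

(** The remaining graph is the same, and the multiplicity gains the one that the cardinality
    loses. *)
Lemma barrierD1 S X v : v \in X -> positive e theta S v ->
  barrier e theta S X = barrier e theta (S :\ v) (X :\ v).
Proof.
move=> vX /andP[vS /eqP Ev]; rewrite /barrier Ev.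
have -> : S :\ v :\: (X :\ v) = S :\: X by rewrite setDDl setD1K.
have -> : (X :\ v \subset S :\ v) = (X \subset S).
  rewrite subsetD1 setD11 andbT; apply/idP/idP => [sX|]; last first.
    exact: subset_trans (subD1set _ _).
  by rewrite -(setD1K vX) subUset sub1set vS.
by rewrite [in LHS](cardsD1 v) vX; congr (_ && _); apply/eqP/eqP; lia.
Qed.

Lemma barrierU1 S X v : positive e theta S v -> barrier e theta (S :\ v) X ->
  barrier e theta S (v |: X).
Proof.
move=> pv bX; have vX : v \notin X.
  by case/andP: bX => /subsetP sX _; apply/negP => /sX; rewrite setD11.
by rewrite (barrierD1 (setU11 v X) pv) setU1K.
Qed.

Lemma elementary_iff_partition S :
  elementary e theta S <-> partition (barriers e theta S :\ set0) S.
Proof.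
split=> [/andP[/andP[_ /forall_inP pos] /forall_inP P0]|].
  apply/and3P; split; last by rewrite setD11.
    rewrite eqEsubset; apply/andP; split.
      apply/bigcupsP => X; rewrite in_setD1 inE => /andP[_ bX].
      by case/andP: bX.
    apply/subsetP => v vS; apply/bigcupP; exists (v |: A_set e theta (S :\ v)).
      rewrite in_setD1 inE barrierU1 ?pos ?barrier_A_set ?andbT //.
      by apply/set0Pn; exists v; exact: setU11.
    exact: setU11.
  apply/trivIsetP => X Y; rewrite !in_setD1 !inE => /andP[_ bX] /andP[_ bY].
  apply: contraNT; rewrite -setI_eq0 => /set0Pn[v]; rewrite inE => /andP[vX vY].
  have vS : v \in S by case/andP: bX => /subsetP sX _; exact: sX.
  rewrite -(setD1K vX) -(setD1K vY).
  move: bX bY; rewrite (barrierD1 vX (pos v vS)) (barrierD1 vY (pos v vS)).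
  by do 2![move/(barrier_unique (eqP (P0 v vS)))->].
case/and3P=> /eqP cov tI _.
have mem_bar X v : barrier e theta S X -> v \in X -> X \in barriers e theta S :\ set0.
  by move=> bX vX; rewrite in_setD1 inE bX andbT; apply/set0Pn; exists v.
have pos v : v \in S -> positive e theta S v.
  rewrite -{1}cov => /bigcupP[X]; rewrite in_setD1 inE => /andP[_ bX] vX.
  exact: barrier_positive bX vX.
apply/andP; split.
  apply/andP; split; last by apply/forall_inP.
  (* Positive multiplicity would yield an essential vertex, but all are positive. *)
  rewrite -leqn0 leqNgt; apply/negP => /mult_gt0_essential[u uS].
  by have /andP[_ /eqP] := pos u uS; mup_lia.
apply/forall_inP => v vS; apply: contraT => /set0Pn[u]; rewrite inE.
case/andP=> pu nA; have bA := barrierU1 (pos v vS) (barrier_A_set (S :\ v)).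
have bB := barrierU1 (pos v vS) (barrierU1 pu (barrier_A_set (S :\ v :\ u))).
have mA := mem_bar _ _ bA (setU11 _ _); have mB := mem_bar _ _ bB (setU11 _ _).
(* Both barriers contain [v], so they are the same block. *)
have EAB : v |: A_set e theta (S :\ v) = v |: (u |: A_set e theta (S :\ v :\ u)).
  by rewrite -(def_pblock tI mA (setU11 _ _)) (def_pblock tI mB (setU11 _ _)).
have : u \in v |: A_set e theta (S :\ v) by rewrite EAB !inE eqxx orbT.
rewrite in_setU1 (negbTE nA) orbF => /eqP uv.
by case/andP: pu; rewrite uv setD11.
Qed.

End GallaiEdmonds.

Theorem theorem3p13 (R : realType) (T : finType) (e : rel T)
    (e_sym : symmetric e) (e_irr : irreflexive e) (theta : R) :
  elementary e theta [set: T] <->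
  partition (barriers e theta [set: T] :\ set0) [set: T].
Proof. exact: elementary_iff_partition. Qed.
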